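(* Let $\mathcal{O}$ be a nonempty set of quantum channels on $n$ qubits and $\Psi$ a channel on $n$ qubits with $\gamma(\Psi)<\infty$. Then for every sample $S=(z_1,\ldots,z_m)$ with $z_i\in\mathbb{F}_2^n\times\mathbb{F}_2^n$, \[ \hat{G}_S(\mathcal{F}(\mathcal{O}))\le\hat{G}_S(\mathcal{F}(\mathcal{O}\cup\{\Psi\}))\le(1+\gamma(\Psi))\,\hat{G}_S(\mathcal{F}(\mathcal{O})), \] and for every distribution $D$ on $\mathbb{F}_2^n\times\mathbb{F}_2^n$, $G_D(\mathcal{F}(\mathcal{O}))\le G_D(\mathcal{F}(\mathcal{O}\cup\{\Psi\}))\le(1+\gamma(\Psi))G_D(\mathcal{F}(\mathcal{O}))$.
   Context: A quantum channel on $n$ qubits is a completely positive trace-preserving linear map on $2^n\times2^n$ complex matrices. For a channel $\Phi$, $f_\Phi(x,y)=\mathrm{Tr}[\Phi(|x\rangle\langle x|)\,|y\rangle\langle y|]$; $\mathcal{F}(\Omega)=\{f_\Phi:\Phi\in\Omega\}$. Empirical Gaussian complexity: $\hat{G}_S(\mathcal{G})=\mathbb{E}_{g}[\sup_{h\in\mathcal{G}}\frac1m\sum_{i=1}^m g_i h(z_i)]$ with $g_1,\ldots,g_m$ i.i.d. $\mathcal{N}(0,1)$; $G_D(\mathcal{G})=\mathbb{E}_{S\sim D^m}\hat{G}_S(\mathcal{G})$. Free robustness w.r.t. $\mathcal{O}$: $\gamma(\Psi)=\inf\{\lambda\ge0:\exists\,\Phi\in\mathrm{Conv}(\mathcal{O}),\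 (\Psi+\lambda\Phi)/(1+\lambda)\in\mathrm{Conv}(\mathcal{O})\}$. *)

(* Defs.v *)
From HB Require Import structures.
From mathcomp Require Import all_boot all_order all_algebra.
From mathcomp Require Import complex.
From mathcomp Require Import all_classical all_reals all_analysis.

Set Implicit Arguments.
Unset Strict Implicit.
Unset Printing Implicit Defensive.

Import Order.TTheory GRing.Theory Num.Theory.
Local Open Scope classical_set_scope.
Local Open Scope ring_scope.

Section QuantumDefs.
Variable R : realType.
Local Notation C := R[i].

(* computational basis of n qubits is labelled by 'I_(2^n)  (identified with F_2^n) *)
Definition qdim (n : nat) := (2 ^ n)%N.

Definition supop (n : nat) := 'M[C]_(qdim n) -> 'M[C]_(qdim n).

(* block matrix X = (X a b)_{a,b<k} in M_k(M_N) = M_{kN} is positive semidefinite: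
   v^* X v >= 0 for every vector v = (v a)_{a<k} in C^k (x) C^N *)
Definition block_psd (N k : nat) (X : 'I_k -> 'I_k -> 'M[C]_N) : Prop :=
  forall v : 'I_k -> 'I_N -> C,
    0 <= \sum_(a < k) \sum_(b < k) \sum_(i < N) \sum_(j < N)
           (v a i)^* * X a b i j * v b j.

Definition completely_positive (n : nat) (Phi : supop n) : Prop :=
  forall (k : nat) (X : 'I_k -> 'I_k -> 'M[C]_(qdim n)),
    block_psd X -> block_psd (fun a b => Phi (X a b)).

Definition trace_preserving (n : nat) (Phi : supop n) : Prop :=
  forall X : 'M[C]_(qdim n), \tr (Phi X) = \tr X.

Definition is_channel (n : nat) (Phi : supop n) : Prop :=
  linear Phi /\ completely_positive Phi /\ trace_preserving Phi.

Definition conv_hull (n : nat) (O : set (supop n)) : set (supop n) :=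
  fun Phi => exists (k : nat) (p : 'I_k -> R) (Phis : 'I_k -> supop n),
    [/\ forall i, 0 <= p i, \sum_(i < k) p i = 1, forall i, O (Phis i)
      & Phi = fun X => \sum_(i < k) (p i)%:C%C *: Phis i X].

(* free robustness of Psi w.r.t. O (inf of empty set = +oo) *)
Definition robustness (n : nat) (O : set (supop n)) (Psi : supop n) : \bar R :=
  ereal_inf [set lam%:E | lam in
    [set lam : R | 0 <= lam /\
       exists Phi, conv_hull O Phi /\
         conv_hull O (fun X => (1 + lam)^-1%:C%C *: (Psi X + lam%:C%C *: Phi X))]].

(* f_Phi(x,y) = Tr[Phi(|x><x|) |y><y|]  (a real number for a channel;
   we take its real part to view it as a real-valued function) *)
Definition fPhi (n : nat) (Phi : supop n) (z : 'I_(qdim n) * 'I_(qdim n)) : R :=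
  complex.Re (\tr (Phi (delta_mx z.1 z.1) *m delta_mx z.2 z.2)).

Definition Fclass (n : nat) (O : set (supop n))
  : set ('I_(qdim n) * 'I_(qdim n) -> R) := [set fPhi Phi | Phi in O].

(* expectation over g_0, g_1, ..., g_(m-1) i.i.d. N(0,1), as an iterated
   integral against the standard normal law (coordinates >= m are unused) *)
Fixpoint gauss_expect (m : nat) (F : (nat -> R) -> \bar R) : \bar R :=
  match m with
  | 0 => F (fun _ => 0)
  | m'.+1 => (\int[normal_prob (0:R) 1]_x
               gauss_expect m' (fun g => F (fun k => if k is k'.+1 then g k' else x)))%E
  end.

Definition emp_gauss_cplx (T : Type) (m : nat) (S : 'I_m -> T) (G : set (T -> R))
  : \bar R :=
  gauss_expect m (fun g =>
    ereal_sup [set ((\sum_(i < m) g (val i) * h (S i)) / m%:R)%:E | h in G]).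

Definition is_distribution (T : finType) (D : T -> R) : Prop :=
  (forall z, 0 <= D z) /\ \sum_(z : T) D z = 1.

Definition gauss_cplx (T : finType) (D : T -> R) (m : nat) (G : set (T -> R))
  : \bar R :=
  (\sum_(S : {ffun 'I_m -> T}) (\prod_(i < m) D (S i))%:E * emp_gauss_cplx S G)%E.

End QuantumDefs.

(* Main.v *)
(* Write A(g) for the supremum over h in F(O) of <g, h> = (1/m) sum_i g_i h(z_i).
   If Psi = (1 + lam) Phi' - lam Phi with Phi, Phi' in Conv(O), then f_Phi and f_Phi'
   satisfy <g, f> <= A(g), so every h in F(O `|` {Psi}) satisfies
   <g, h> <= (1 + lam) A(g) - lam <g, f_Phi>, and the last term has mean zero.
   Taking the infimum over lam gives the factor 1 + gamma(Psi). Channels have f in [0, 1],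
   so A is Lipschitz; all the integrals are therefore finite and linear, even though O
   may be uncountable. *)
Require Import Defs.
From HB Require Import structures.
From mathcomp Require Import all_boot all_order all_algebra.
From mathcomp Require Import complex.
From mathcomp Require Import all_classical all_reals all_analysis.
From mathcomp Require Import measurable_realfun ring lra.

Import Order.TTheory GRing.Theory Num.Theory.
Local Open Scope classical_set_scope.
Local Open Scope ring_scope.

(** * The standard normal law: integrability and symmetry of the first moment *)

Section StandardNormal.
Variable R : realType.
Local Notation mu := (@lebesgue_measure R).
Local Notation N01 := (normal_prob (0 : R) 1).

Lemma ge0_integral_normal_prob (f : R -> \bar R) :
  (forall x, 0 <= f x)%E -> measurable_fun setT f ->
  (\int[N01]_x f x = \int[mu]_x (f x * (normal_pdf 0 1 x)%:E))%E.
Proof.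
move=> f0 mf.
have dom : N01 `<< mu := normal_prob_dominates 0 1.
rewrite -(Radon_Nikodym_SigmaFinite.change_of_variables dom)//.
apply: ae_eq_integral => //.
- apply: emeasurable_funM => //; apply: (measurable_int mu).
  exact: Radon_Nikodym_SigmaFinite.f_integrable.
- apply: emeasurable_funM => //; apply/measurableT_comp => //.
  exact: measurable_normal_pdf.
(* The Radon-Nikodym derivative and the Gaussian density have the same integral over every
   measurable set, so they agree almost everywhere. *)
- apply: ae_eqe_mul2l => /=; apply: integral_ae_eq => //=.
  + exact: Radon_Nikodym_SigmaFinite.f_integrable.
  + by apply/measurableT_comp => //; exact: measurable_normal_pdf.
  + by move=> E _ mE; rewrite -Radon_Nikodym_SigmaFinite.f_integral.
Qed.

(** Splitting exp(-x^2/2) into two factors exp(-x^2/4), one absorbs [|x|] and the other is, up to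
    the ratio of peaks, the density of variance 2. This gives an integrable majorant for the first
    moment. *)
Lemma normal_pdf01_bound (x : R) :
  `|x| * normal_pdf 0 1 x <=
  (normal_peak 1 / normal_peak (Num.sqrt 2)) * normal_pdf 0 (Num.sqrt 2) x.
Proof.
have s2 : Num.sqrt (2 : R) != 0 by rewrite gt_eqF// sqrtr_gt0.
rewrite !normal_pdfE// ?oner_neq0// mulrA divfK; last first.
  by rewrite gt_eqF// normal_peak_gt0.
rewrite mulrCA ler_wpM2l ?normal_peak_ge0//.
rewrite /normal_fun !subr0 expr1n sqr_sqrtr//.
have -> : - x ^+ 2 / (1 *+ 2) = - x ^+ 2 / (2 *+ 2) - x ^+ 2 / 4 :> R by lra.
rewrite expRD mulrCA ler_piMr ?expR_ge0//.
(* |x| <= 1 + x^2 / 4 <= exp (x^2 / 4) *)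
rewrite expRN ler_pdivrMr ?expR_gt0// mul1r.
apply: le_trans (expR_ge1Dx _).
have := sqr_ge0 (`|x| - 2); rewrite -(real_normK (num_real x)); nra.
Qed.

Lemma integrable_normal_id : N01.-integrable [set: R] EFin.
Proof.
apply/integrableP; split; first exact: EFin_measurable.
rewrite ge0_integral_normal_prob//; last first.
  by apply: measurableT_comp => //; exact: EFin_measurable.
have : mu.-integrable [set: R] (fun x =>
    (normal_peak 1 / normal_peak (Num.sqrt 2))%:E * (normal_pdf 0 (Num.sqrt 2) x)%:E)%E.
  by apply: integrableZl => //; exact: integrable_normal_pdf.
move=> /integrableP[mg]; apply: le_lt_trans.
apply: ge0_le_integral => //=.
- by move=> x _; rewrite mule_ge0// lee_fin normal_pdf_ge0.
- apply: emeasurable_funM; first exact: measurableT_comp.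
  by apply/measurableT_comp => //; exact: measurable_normal_pdf.
- apply/measurable_EFinP/measurableT_comp => //; apply: measurable_funM => //; exact: measurable_normal_pdf.
- move=> x _; rewrite -EFinM lee_fin [leRHS]ger0_norm; first exact: normal_pdf01_bound.
  by rewrite !mulr_ge0 ?invr_ge0 ?normal_peak_ge0 ?normal_pdf_ge0.
Qed.

(** Lebesgue measure is invariant under reflection and the centred density is even. *)
Lemma normal_prob_oppr (A : set R) : measurable A ->
  pushforward N01 (-%R : _ -> measurableTypeR R) A = N01 A.
Proof.
move=> mA; rewrite /pushforward /normal_prob.
have mpdf : measurable_fun [set: R] (fun x : R => (normal_pdf 0 1 x)%:E).
  by apply/measurableT_comp => //; exact: measurable_normal_pdf.
rewrite -[RHS](@eq_measure_integral _ _ _ _ _ (pushforward mu (-%R : _ -> measurableTypeR R))); last first.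
  by move=> B mB _; exact: lebesgue_measureN.
rewrite ge0_integral_pushforward//; last 2 first.
- exact: measurable_funTS.
- by move=> x _; rewrite lee_fin normal_pdf_ge0.
apply: eq_integral => x _ /=; congr (_%:E).
by rewrite !normal_pdfE ?oner_neq0// /normal_fun !subr0 sqrrN.
Qed.

(** By reflection the integral equals its own opposite; being finite, it is zero. *)
Lemma integral_normal_id : (\int[N01]_x x%:E = 0)%E.
Proof.
have iN := integrable_normal_id.
have fin : (\int[N01]_x x%:E)%E \is a fin_num by exact: integrable_fin_num.
have : (\int[N01]_x x%:E = - \int[N01]_x x%:E)%E.
  rewrite -{1}(@eq_measure_integral _ _ _ _ _ (pushforward N01 (-%R : _ -> measurableTypeR R))); last first.
    by move=> A mA _; exact: normal_prob_oppr.
  have EN : EFin \o (-%R : R -> R) = (fun x => (- x%:E)%E) by [].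
  rewrite integral_pushforward//=; last first.
    by rewrite preimage_setT EN; exact: integrableN.
  rewrite -integralN//; exact: integrable_add_def.
move: fin; case: (\int[N01]_x x%:E)%E => //= r _ [] e; congr (_%:E); lra.
Qed.
End StandardNormal.

(** * Iterated Gaussian expectations: monotonicity, and linearity on Lipschitz functions *)

Section GaussExpect.
Import numFieldNormedType.Exports.
Variable R : realType.
Local Notation N01 := (normal_prob (0 : R) 1).
Implicit Types (m : nat) (L : R) (g : nat -> R).

(** Covers integrands of unknown measurability: the integral is a difference of suprema over simple
    functions below the positive and negative parts, and each supremum is monotone. *)
Lemma le_integral_pointwise d (T : measurableType d) (mu : {measure set T -> \bar R})
    (f1 f2 : T -> \bar R) : (forall x, f1 x <= f2 x)%E ->
  (\int[mu]_x f1 x <= \int[mu]_x f2 x)%E.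
Proof.
move=> f12; rewrite /integral !patch_setT; apply: leeB.
  apply: ereal_sup_le => _ [h /= hf <-]; exists h => //= x.
  by apply: le_trans (hf x) _; rewrite !funeposE ge_max !le_max f12 lexx orbT.
apply: ereal_sup_le => _ [h /= hf <-]; exists h => //= x.
by apply: le_trans (hf x) _; rewrite !funenegE ge_max !le_max leeN2 f12 lexx orbT.
Qed.

Lemma le_gauss_expect m (F G : (nat -> R) -> \bar R) :
  (forall g, F g <= G g)%E -> (gauss_expect m F <= gauss_expect m G)%E.
Proof.
elim: m F G => [|m IH] F G FG /=; first exact: FG.
by apply: le_integral_pointwise => x; apply: IH => g; exact: FG.
Qed.

Lemma gauss_expect_cst m (c : R) : gauss_expect m (fun=> c%:E) = c%:E.
Proof.
elim: m => //= m IH; under eq_integral do rewrite IH.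
by rewrite integral_cst// [X in (_ * X)%E](@probability_setT _ _ _ N01) mule1.
Qed.

(** Continuity gives measurability, and [|phi 0| + L * |x|] is an integrable majorant. *)
Lemma lipschitz_integrable_normal (phi : R -> R) L :
  (forall x y, `|phi x - phi y| <= L * `|x - y|) ->
  N01.-integrable [set: R] (EFin \o phi).
Proof.
move=> lip.
have L0 : 0 <= L by have := le_trans (normr_ge0 _) (lip 1 0); rewrite subr0 normr1 mulr1.
(* [L] may be zero; [L + 1] is a Lipschitz constant one can divide by. *)
have L1 : 0 < L + 1 by lra.
have cphi : continuous phi.
  move=> x; apply/cvgrPdist_le => /= e e0; near=> y.
  apply: le_trans (lip x y) _.
  apply: (@le_trans _ _ ((L + 1) * `|x - y|)); first by rewrite ler_wpM2r//; lra.
  rewrite -ler_pdivlMl// mulrC; near: y.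
  by apply: cvgr_dist_le => //; rewrite divr_gt0.
have mphi : measurable_fun [set: R] phi by exact: continuous_measurable_fun.
apply: (@le_integrable _ _ _ N01 _ measurableT _
  (fun x => (`|phi 0|%:E + L%:E * `|x%:E|)%E)).
- exact/measurable_EFinP.
- move=> x _ /=; rewrite lee_fin [leRHS]ger0_norm ?addr_ge0 ?mulr_ge0//.
  have := lip x 0; rewrite subr0 => H.
  rewrite -[phi x](subrK (phi 0)) addrC (le_trans (ler_normD _ _))// lerD//.
- apply: integrableD => //.
    exact: finite_measure_integrable_cst.
  by apply: integrableZl => //; apply: integrable_abse; exact: integrable_normal_id.
Unshelve. all: by end_near. Qed.

(** Names the sequence that [gauss_expect] builds at each integration, the outer variable being
    coordinate 0. *)
Definition scons (x : R) g : nat -> R := fun k => if k is k'.+1 then g k' else x.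

(** The l1 distance lets one coordinate be split off at a time; the bound also forces [F] to depend
    on the first [m] coordinates only. *)
Definition lip1 m L (F : (nat -> R) -> R) :=
  forall g g', `|F g - F g'| <= L * \sum_(i < m) `|g i - g' i|.

Lemma lip1_cst m (c : R) : lip1 m 0 (fun=> c).
Proof. by move=> g g'; rewrite subrr normr0 mul0r. Qed.

Lemma lip1_scons m L F x : lip1 m.+1 L F -> lip1 m L (F \o scons x).
Proof.
move=> lF g g'; apply: le_trans (lF _ _) _.
by rewrite big_ord_recl/= subrr normr0 add0r.
Qed.

Lemma lip1_linear m (c : 'I_m -> R) L : (forall i, `|c i| <= L) ->
  lip1 m L (fun g => \sum_(i < m) c i * g i).
Proof.
move=> cL g g'; rewrite -sumrB (le_trans (ler_norm_sum _ _ _))// mulr_sumr.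
by apply: ler_sum => i _; rewrite -mulrBr normrM ler_wpM2r.
Qed.

(** The constant [L] is common to the family, so the estimate passes to the supremum whatever the
    cardinality of [A]. *)
Lemma lip1_sup m L (I : Type) (A : set I) (F : I -> (nat -> R) -> R) :
  A !=set0 -> (forall i, A i -> lip1 m L (F i)) ->
  (forall g, has_ubound [set F i g | i in A]) ->
  lip1 m L (fun g => sup [set F i g | i in A]).
Proof.
move=> [a Aa] lF ubF.
suff H g g' : sup [set F i g | i in A] <=
    sup [set F i g' | i in A] + L * \sum_(i < m) `|g i - g' i|.
  move=> g g'; rewrite ler_distl; have := H g g'; have := H g' g.
  by under eq_bigr do rewrite distrC; lra.
apply: ge_sup; first by exists (F a g), a.
move=> _ [i Ai <-].
have /(ub_le_sup (ubF g')) : [set F i g' | i in A] (F i g') by exists i.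
have := lF i Ai g g'; rewrite ler_distl; lra.
Qed.

(** Made real-valued by [fine] so that the one-variable Lipschitz criterion applies; for Lipschitz
    [F] the expectation is finite and nothing is lost. *)
Definition gauss_slice m (F : (nat -> R) -> R) (x : R) : R :=
  fine (gauss_expect m (fun g => (F (scons x g))%:E)).

(* Proved jointly: linearity at m makes the slices of the case m + 1 Lipschitz, hence
   integrable. *)
Lemma gauss_expect_lip1 m :
  (forall L F, lip1 m L F -> gauss_expect m (EFin \o F) \is a fin_num) /\
  (forall L L' a b F G, lip1 m L F -> lip1 m L' G ->
     gauss_expect m (fun g => (a * F g + b * G g)%:E) =
     a%:E * gauss_expect m (EFin \o F) + b%:E * gauss_expect m (EFin \o G))%E.
Proof.
elim: m => [|m [IHfin IHlin]]; first by split=> //= *; rewrite EFinD !EFinM.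
have sliceE L F x : lip1 m.+1 L F ->
    gauss_expect m (fun g => (F (scons x g))%:E) = (gauss_slice m F x)%:E.
  by move=> lF; rewrite fineK//; apply: (IHfin L (F \o scons x)); exact: lip1_scons.
have slice_le L F x y : lip1 m.+1 L F ->
    gauss_slice m F x <= gauss_slice m F y + L * `|x - y|.
  move=> lF; rewrite -lee_fin EFinD -(sliceE _ _ _ lF) -(sliceE _ _ y lF).
  (* Linearity at [m], with the constant function 1 as second function, moves the additive constant
     inside the expectation. *)
  have -> : (gauss_expect m (fun g => (F (scons y g))%:E) + (L * `|x - y|)%:E =
      gauss_expect m (fun g => (1 * F (scons y g) + (L * `|x - y|) * 1)%:E))%E.
    rewrite (IHlin L 0 1 _ (F \o scons y) (fun=> 1)); last 2 first.
    - exact: lip1_scons.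
    - exact: lip1_cst.
    by rewrite mul1e gauss_expect_cst mule1.
  apply: le_gauss_expect => g; rewrite lee_fin mul1r mulr1.
  have := lF (scons x g) (scons y g).
  rewrite big_ord_recl/= [X in _ * (_ + X)]big1; last by move=> i _; rewrite subrr normr0.
  by rewrite addr0 ler_distl; lra.
have slice_int L F : lip1 m.+1 L F -> N01.-integrable [set: R] (EFin \o gauss_slice m F).
  move=> lF; apply: (lipschitz_integrable_normal _ L) => x y.
  by rewrite ler_distl; have := slice_le L F x y lF; have := slice_le L F y x lF;
    rewrite distrC; lra.
have intE L F : lip1 m.+1 L F ->
    gauss_expect m.+1 (EFin \o F) = (\int[N01]_x (gauss_slice m F x)%:E)%E.
  by move=> lF; apply: eq_integral => x _; exact: sliceE lF.
split=> [L F lF|L L' a b F G lF lG].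
  by rewrite (intE L)//; apply: integrable_fin_num => //; exact: slice_int lF.
rewrite (intE L)// (intE L')//.
rewrite -integralZl//; last exact: slice_int lF.
rewrite -integralZl//; last exact: slice_int lG.
rewrite -integralD//; last 2 first.
- by apply: integrableZl => //; exact: slice_int lF.
- by apply: integrableZl => //; exact: slice_int lG.
apply: eq_integral => x _.
rewrite -/(scons x) -(sliceE _ _ _ lF) -(sliceE _ _ _ lG).
by apply: (IHlin L L' a b (F \o scons x) (G \o scons x)); exact: lip1_scons.
Qed.

(** The inner expectation kills the tail by induction and leaves [c ord0 * x], whose mean is
    zero. *)
Lemma gauss_expect_linear0 m (c : 'I_m -> R) :
  gauss_expect m (fun g => (\sum_(i < m) c i * g i)%:E) = 0%E.
Proof.
elim: m c => [|m IH] c; first by rewrite /= big_ord0.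
rewrite -[RHS](mule0 (c ord0)%:E) -(integral_normal_id R).
rewrite -integralZl//; last exact: integrable_normal_id.
apply: eq_integral => x _.
(* The head term is constant for the inner expectation; it is written as a multiple of 1 to fit the
   linearity statement. *)
transitivity (gauss_expect m (fun g =>
    (c ord0 * x * 1 + 1 * \sum_(i < m) c (lift ord0 i) * g i)%:E)).
  by congr (gauss_expect m _); apply/funext => g; rewrite big_ord_recl mulr1 mul1r.
have [_ lin] := gauss_expect_lip1 m.
rewrite (lin 0 (\sum_(i < m) `|c (lift ord0 i)|) _ _ (fun=> 1)
  (fun g => \sum_(i < m) c (lift ord0 i) * g i)); last 2 first.
- exact: lip1_cst.
- by apply: lip1_linear => i; rewrite (bigD1 i)//= lerDl sumr_ge0.
by rewrite IH gauss_expect_cst mule1 mule0 adde0 EFinM.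
Qed.
End GaussExpect.

(** * From channels to real functions bounded by 1, and from mixtures to convex combinations *)

Section Channels.
Variables (R : realType) (n : nat).
Local Notation C := R[i].
Implicit Types (Phi Psi : supop R n) (O : set (supop R n)).

Lemma complexReD (x y : C) : complex.Re (x + y) = complex.Re x + complex.Re y.
Proof. by case: x; case: y. Qed.

Lemma complexReZ (r : R) (x : C) : complex.Re (r%:C%C * x) = r * complex.Re x.
Proof. by case: x => a b /=; rewrite mul0r subr0. Qed.

Lemma complexRe_sum (I : Type) (s : seq I) (P : pred I) (F : I -> C) :
  complex.Re (\sum_(i <- s | P i) F i) = \sum_(i <- s | P i) complex.Re (F i).
Proof. exact: (big_morph _ complexReD). Qed.

Lemma mxtrace_mul_delta (F : pzRingType) k (M : 'M[F]_k) i j :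
  \tr (M *m delta_mx i j) = M j i.
Proof.
rewrite /mxtrace (bigD1 j)//= big1 ?addr0; last first.
  by move=> l lj; rewrite mxE big1// => q _; rewrite mxE (negbTE lj) andbF mulr0.
rewrite mxE (bigD1 i)//= big1 ?addr0; last first.
  by move=> l li; rewrite mxE (negbTE li) mulr0.
by rewrite mxE !eqxx mulr1.
Qed.

Lemma fPhiE Phi z : fPhi Phi z = complex.Re (Phi (delta_mx z.1 z.1) z.2 z.2).
Proof. by rewrite /fPhi mxtrace_mul_delta. Qed.

Lemma channel_diag_ge0 Phi x y : completely_positive Phi ->
  0 <= Phi (delta_mx x x) y y.
Proof.
move=> cp.
have psd : block_psd (fun _ _ : 'I_1 => delta_mx x x : 'M[C]_(qdim n)).
  move=> v; rewrite !big_ord1 (bigD1 x)//= [X in _ + X]big1 ?addr0; last first.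
    by move=> i ix; rewrite big1// => j _; rewrite mxE (negbTE ix) mulr0 mul0r.
  rewrite (bigD1 x)//= big1 ?addr0; last first.
    by move=> j jx; rewrite mxE (negbTE jx) andbF mulr0 mul0r.
  by rewrite mxE !eqxx mulr1 mulrC mul_conjC_ge0.
(* Complete positivity at level 1 is plain positivity; testing on the basis vector [y] extracts the
   diagonal entry. *)
have := cp 1%N _ psd (fun _ i => (i == y)%:R).
rewrite !big_ord1 (bigD1 y)//= [X in _ + X]big1 ?addr0; last first.
  by move=> i iy; rewrite big1// => j _; rewrite (negbTE iy) conjC0 !mul0r.
rewrite (bigD1 y)//= big1 ?addr0; last first.
  by move=> j jy; rewrite (negbTE jy) mulr0.
by rewrite !eqxx conjC1 mul1r mulr1.
Qed.

(** For fixed input the values are the output probabilities: nonnegative, and summing to the trace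
    of the output, which is 1. *)
Lemma fPhi_norm_le1 Phi z : is_channel Phi -> `|fPhi Phi z| <= 1.
Proof.
move=> [_ [cp tp]].
have f0 w : 0 <= fPhi Phi w.
  by have := channel_diag_ge0 Phi w.1 w.2 cp; rewrite fPhiE lecE => /andP[].
rewrite ger0_norm//.
have -> : 1 = complex.Re (\tr (Phi (delta_mx z.1 z.1))).
  by rewrite tp -[delta_mx _ _]mul1mx mxtrace_mul_delta mxE eqxx.
rewrite /mxtrace complexRe_sum (bigD1 z.2)//= -fPhiE lerDl sumr_ge0// => y _.
by rewrite -(fPhiE Phi (z.1, y)).
Qed.

(** Counterpart of [conv_hull] for real functions, so that the Gaussian estimates need no reference
    to channels. *)
Definition fun_conv_hull (T : Type) (G : set (T -> R)) : set (T -> R) :=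
  fun f => exists (k : nat) (p : 'I_k -> R) (hs : 'I_k -> T -> R),
    [/\ forall i, 0 <= p i, \sum_(i < k) p i = 1, forall i, G (hs i)
      & forall z, f z = \sum_(i < k) p i * hs i z].

Lemma fPhi_conv_hull O Phi : conv_hull O Phi -> fun_conv_hull _ (Fclass O) (fPhi Phi).
Proof.
move=> [k [p [Phis [p0 p1 OPhis ->]]]].
exists k, p, (fun i => fPhi (Phis i)); split=> // [i|z]; first by exists (Phis i).
rewrite fPhiE summxE complexRe_sum; apply: eq_bigr => i _.
by rewrite mxE complexReZ fPhiE.
Qed.

Lemma fPhi_mix Psi Phi (lam : R) z :
  fPhi (fun X => (1 + lam)^-1%:C%C *: (Psi X + lam%:C%C *: Phi X)) z =
  (1 + lam)^-1 * (fPhi Psi z + lam * fPhi Phi z).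
Proof. by rewrite !fPhiE mxE complexReZ mxE complexReD mxE complexReZ. Qed.

Lemma Fclass_setU1 O Psi : Fclass (O `|` [set Psi]) = Fclass O `|` [set fPhi Psi].
Proof. by rewrite /Fclass image_setU image_set1. Qed.

End Channels.

(** * Empirical Gaussian complexity of a nonempty class bounded by 1 *)

Section EmpiricalGaussian.
Variables (R : realType) (T : Type) (m : nat) (S : 'I_m -> T).
Implicit Types (G : set (T -> R)) (g : nat -> R) (h f : T -> R).

Definition sample_corr h g : R := (\sum_(i < m) g (val i) * h (S i)) / m%:R.

Lemma sample_corrE h g :
  sample_corr h g = \sum_(i < m) (h (S i) / m%:R) * g i.
Proof.
by rewrite /sample_corr mulr_suml; apply: eq_bigr => i _; ring.
Qed.

Lemma lip1_sample_corr h : (forall z, `|h z| <= 1) -> lip1 R m 1 (sample_corr h).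
Proof.
move=> h1; have -> : sample_corr h = (fun g => \sum_(i < m) (h (S i) / m%:R) * g i).
  by apply/funext => g; exact: sample_corrE.
apply: lip1_linear => i; rewrite normrM mulr_ile1//.
(* The index [i] itself shows that [m] is positive, so [1 / m] is at most 1. *)
rewrite normfV normr_nat; have : (0 < m)%N by exact: leq_ltn_trans (ltn_ord i).
by move=> m0; rewrite invf_le1 ?ltr0n// ler1n.
Qed.

Lemma sample_corr_combo k (p : 'I_k -> R) (hs : 'I_k -> T -> R) h g :
  (forall z, h z = \sum_(j < k) p j * hs j z) ->
  sample_corr h g = \sum_(j < k) p j * sample_corr (hs j) g.
Proof.
move=> hE; rewrite sample_corrE.
under [RHS]eq_bigr do rewrite sample_corrE mulr_sumr.
rewrite exchange_big; apply: eq_bigr => i _ /=.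
by rewrite hE !mulr_suml; apply: eq_bigr => j _; rewrite !mulrA.
Qed.

(** Real-valued for the Lipschitz estimates; [emp_gauss_cplxE] matches it with the extended
    supremum. *)
Definition corr_sup G g : R := sup [set sample_corr h g | h in G].

Section BoundedClass.
Variable G : set (T -> R).
Hypotheses (G0 : G !=set0) (Gb : forall h, G h -> forall z, `|h z| <= 1).

Lemma has_ubound_sample_corr g : has_ubound [set sample_corr h g | h in G].
Proof.
(* The Lipschitz estimate against the zero vector, where every correlation vanishes. *)
exists (1 * \sum_(i < m) `|g i - 0|) => _ [h Gh <-].
have := lip1_sample_corr h (Gb h Gh) g (fun=> 0).
rewrite (sample_corrE h (fun=> 0)) big1 ?subr0; last by move=> i _; rewrite mulr0.
by apply: le_trans; exact: ler_norm.
Qed.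

Lemma sample_corr_le_sup h g : G h -> sample_corr h g <= corr_sup G g.
Proof. by move=> Gh; apply: ub_le_sup; [exact: has_ubound_sample_corr|exists h]. Qed.

(** A linear functional on a convex hull never exceeds its supremum over the generators. *)
Lemma sample_corr_hull_le_sup h g : fun_conv_hull R T G h ->
  sample_corr h g <= corr_sup G g.
Proof.
move=> [k [p [hs [p0 p1 Ghs hE]]]]; rewrite (sample_corr_combo _ _ _ _ _ hE).
rewrite -[leRHS]mul1r -p1 mulr_suml; apply: ler_sum => j _.
by rewrite ler_wpM2l// sample_corr_le_sup.
Qed.

Lemma lip1_corr_sup : lip1 R m 1 (corr_sup G).
Proof.
by apply: lip1_sup => // [h Gh|g]; [exact/lip1_sample_corr/Gb|exact: has_ubound_sample_corr].
Qed.

Lemma emp_gauss_cplxE : emp_gauss_cplx S G = gauss_expect m (EFin \o corr_sup G).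
Proof.
congr (gauss_expect m _); apply/funext => g /=.
rewrite /corr_sup -ereal_sup_EFin; last 2 first.
- exact: has_ubound_sample_corr.
- by case: G0 => h Gh; exists (sample_corr h g), h.
by rewrite image_comp.
Qed.

Lemma emp_gauss_cplx_fin_num : emp_gauss_cplx S G \is a fin_num.
Proof.
by rewrite emp_gauss_cplxE; apply: (gauss_expect_lip1 R m).1; exact: lip1_corr_sup.
Qed.

Lemma gauss_expect_sample_corr h : gauss_expect m (EFin \o sample_corr h) = 0%E.
Proof.
rewrite -(gauss_expect_linear0 R m (fun i => h (S i) / m%:R)).
by congr (gauss_expect m _); apply/funext => g /=; rewrite sample_corrE.
Qed.

(** A single member of [G] has a correlation of mean zero lying below the supremum. *)
Lemma emp_gauss_cplx_ge0 : (0 <= emp_gauss_cplx S G)%E.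
Proof.
case: G0 => h Gh; rewrite -(gauss_expect_sample_corr h) emp_gauss_cplxE.
by apply: le_gauss_expect => g; rewrite lee_fin sample_corr_le_sup.
Qed.

(* With a = f_Phi, every h in G and h = f_Psi satisfy <g,h> <= (1 + lam) sup_G - lam <g,a>,
   and the last term has mean zero; bounding -<g,a> by sup_G(-g) instead would only
   give the factor 1 + 2 lam. *)
Lemma emp_gauss_cplx_setU1 f a (lam : R) : 0 <= lam ->
  fun_conv_hull R T G a ->
  fun_conv_hull R T G (fun z => (1 + lam)^-1 * (f z + lam * a z)) ->
  (emp_gauss_cplx S (G `|` [set f]) <= (1 + lam)%:E * emp_gauss_cplx S G)%E.
Proof.
move=> lam0 Ga Gmix; have lam1 : 0 < 1 + lam by lra.
have la : lip1 R m 1 (sample_corr a).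
  apply: lip1_sample_corr => z; case: Ga => k [p [hs [p0 p1 Ghs ->]]].
  rewrite (le_trans (ler_norm_sum _ _ _))// -p1; apply: ler_sum => j _.
  by rewrite normrM ger0_norm// ler_piMr// Gb.
have := (gauss_expect_lip1 R m).2 1 1 (1 + lam) (- lam) _ _ lip1_corr_sup la.
rewrite gauss_expect_sample_corr mule0 adde0 -emp_gauss_cplxE => <-.
apply: le_gauss_expect => g; apply: ge_ereal_sup => _ [h + <-].
rewrite lee_fin -/(sample_corr h g).
have aA := sample_corr_hull_le_sup a g Ga.
case=> [Gh|->].
  (* With A the supremum, A = (1 + lam) A - lam A, and lam A dominates lam times the correlation of
     [a]. *)
  have := sample_corr_le_sup h g Gh; nra.
have := sample_corr_hull_le_sup _ g Gmix.
have -> : sample_corr (fun z => (1 + lam)^-1 * (f z + lam * a z)) g =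
    (1 + lam)^-1 * (sample_corr f g + lam * sample_corr a g).
  rewrite !sample_corrE mulr_sumr -big_split mulr_sumr/=.
  by apply: eq_bigr => i _; ring.
by rewrite ler_pdivrMl//; lra.
Qed.

End BoundedClass.

Lemma le_emp_gauss_cplx G1 G2 : G1 `<=` G2 ->
  (emp_gauss_cplx S G1 <= emp_gauss_cplx S G2)%E.
Proof.
by move=> G12; apply: le_gauss_expect => g; exact/ereal_sup_le/image_subset.
Qed.

End EmpiricalGaussian.

(** * Passage to the infimum over lam *)

Section Robustness.
Variables (R : realType) (n : nat) (O : set (supop R n)) (Psi : supop R n).
Hypotheses (O0 : O !=set0) (Och : forall Phi, O Phi -> is_channel Phi).
Hypothesis rob_lty : (robustness O Psi < +oo)%E.

Lemma robustness_fin_num : robustness O Psi \is a fin_num.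
Proof.
rewrite ge0_fin_numE//; apply: le_ereal_inf_tmp => _ [lam [lam0 _] <-].
by rewrite lee_fin.
Qed.

Lemma Fclass_bounded h : Fclass O h -> forall z, `|h z| <= 1.
Proof. by move=> [Phi OPhi <-] z; exact/fPhi_norm_le1/Och. Qed.

Lemma Fclass_nonempty : Fclass O !=set0.
Proof. by case: O0 => Phi OPhi; exists (fPhi Phi), Phi. Qed.

(** The infimum need not be attained, so the bound is proved up to [e] from a feasible [lam] close
    to it. *)
Lemma emp_gauss_cplx_robustness m (S : 'I_m -> 'I_(qdim n) * 'I_(qdim n)) :
  (emp_gauss_cplx S (Fclass (O `|` [set Psi]))
     <= (1 + robustness O Psi) * emp_gauss_cplx S (Fclass O))%E.
Proof.
have Efin := emp_gauss_cplx_fin_num R _ m S _ Fclass_nonempty Fclass_bounded.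
have := emp_gauss_cplx_ge0 R _ m S _ Fclass_nonempty Fclass_bounded.
rewrite -(fineK Efin) -(fineK robustness_fin_num).
set v := fine (emp_gauss_cplx _ _); set r := fine _; rewrite lee_fin => v0.
apply/lee_addgt0Pr => e e0.
(* The slack [e / (v + 1)] costs at most [e] once multiplied by [v], and stays defined when [v] is
   zero. *)
have v1 : 0 < v + 1 by lra.
have : (robustness O Psi < (r + e / (v + 1))%:E)%E.
  by rewrite -(fineK robustness_fin_num) lte_fin ltrDl divr_gt0.
move=> /ereal_inf_lt[_ [lam [lam0 [Phi [OPhi Omix]]] <-]]; rewrite lte_fin => lamr.
rewrite Fclass_setU1.
apply: le_trans (emp_gauss_cplx_setU1 R _ m S _ Fclass_nonempty Fclass_bounded
  _ (fPhi Phi) lam lam0 _ _) _.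
- exact: fPhi_conv_hull.
- have := fPhi_conv_hull _ _ _ _ Omix.
  by congr (fun_conv_hull _ _ _ _); apply/funext => z; exact: fPhi_mix.
rewrite -(fineK Efin) -/v -EFinM -[leRHS]/(((1 + r) * v + e)%:E) lee_fin.
have ev : e / (v + 1) * v <= e.
  by rewrite mulrAC ler_pdivrMr// ler_wpM2l ?ltW//; lra.
apply: (@le_trans _ _ ((1 + (r + e / (v + 1))) * v)).
  by rewrite ler_wpM2r//; lra.
by rewrite !mulrDl; lra.
Qed.

End Robustness.

Theorem mainTheorem10 (R : realType) (n : nat)
    (O : set (supop R n)) (Psi : supop R n) :
  O !=set0 ->
  (forall Phi, O Phi -> is_channel Phi) ->
  is_channel Psi ->
  (robustness O Psi < +oo)%E ->
  (forall (m : nat) (S : 'I_m -> 'I_(qdim n) * 'I_(qdim n)),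
     (emp_gauss_cplx S (Fclass O) <= emp_gauss_cplx S (Fclass (O `|` [set Psi])))%E /\
     (emp_gauss_cplx S (Fclass (O `|` [set Psi]))
        <= (1 + robustness O Psi) * emp_gauss_cplx S (Fclass O))%E) /\
  (forall (D : 'I_(qdim n) * 'I_(qdim n) -> R) (m : nat),
     is_distribution D ->
     (gauss_cplx D m (Fclass O) <= gauss_cplx D m (Fclass (O `|` [set Psi])))%E /\
     (gauss_cplx D m (Fclass (O `|` [set Psi]))
        <= (1 + robustness O Psi) * gauss_cplx D m (Fclass O))%E).
Proof.
move=> O0 Och _ rob_lty.
have lower m (S : 'I_m -> 'I_(qdim n) * 'I_(qdim n)) :
    (emp_gauss_cplx S (Fclass O) <= emp_gauss_cplx S (Fclass (O `|` [set Psi])))%E.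
  by apply: le_emp_gauss_cplx; rewrite Fclass_setU1; exact: subsetUl.
have upper m (S : 'I_m -> 'I_(qdim n) * 'I_(qdim n)) :=
  emp_gauss_cplx_robustness R n O Psi O0 Och rob_lty m S.
split=> [m S|D m [D0 _]]; first by split; [exact: lower|exact: upper].
have D0S (S : {ffun 'I_m -> 'I_(qdim n) * 'I_(qdim n)}) :
    (0 <= (\prod_(i < m) D (S i))%:E)%E by rewrite lee_fin prodr_ge0.
split; first by apply: lee_sum => S _; rewrite lee_wpmul2l.
(* Distributing the factor over a sum of extended reals uses that every term is nonnegative. *)
rewrite /gauss_cplx ge0_sume_distrr; last first.
  move=> S _; rewrite mule_ge0//.
  by apply: (emp_gauss_cplx_ge0 R _ m S); [exact: Fclass_nonempty|exact: Fclass_bounded].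
by apply: lee_sum => S _; rewrite muleCA lee_wpmul2l.
Qed.
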